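(* Let $\mathbb{F}=\mathbb{R}$ or $\mathbb{C}$, and set $\alpha=1$ if $\mathbb{F}=\mathbb{R}$ and $\alpha=2$ if $\mathbb{F}=\mathbb{C}$. Let $n\ge1$, let $\mathcal{S}\subseteq\mathcal{S}'\subseteq\mathbb{F}^n$ be linear subspaces, let $p=\dim(\mathcal{S})$ and $q=\dim(\mathcal{S}')-\dim(\mathcal{S})$, and assume $q\le p$. Let $\mathcal{M}_{\mathrm{sym}}(\mathcal{S},\mathcal{S}'):=\{A\in\mathrm{Sym}(n):\mathcal{S}+A\mathcal{S}=\mathcal{S}'\}$, $\mathcal{M}_{\mathrm{sym,inv}}(\mathcal{S},\mathcal{S}'):=\mathcal{M}_{\mathrm{sym}}(\mathcal{S},\mathcal{S}')\cap\mathrm{GL}(n)$, and $\mathcal{M}_{\mathrm{pos}}(\mathcal{S},\mathcal{S}'):=\mathcal{M}_{\mathrm{sym}}(\mathcal{S},\mathcal{S}')\cap\mathrm{P}^+(n)$. Then: (i) $\mathcal{M}_{\mathrm{sym,inv}}(\mathcal{S},\mathcal{S}')$ (resp. $\mathcal{M}_{\mathrm{pos}}(\mathcal{S},\mathcal{S}')$) is a smooth embedded submanifold of $\mathrm{GL}(n)\cap\mathrm{Sym}(n)$ (resp. $\mathrm{P}^+(n)$) of dimension $\alpha\,\big(n(n-1)/2-p(n-p-q)\big)+n$. (ii) $\mathcal{M}_{\mathrm{sym,inv}}(\mathcal{S},\mathcal{S}')$ and $\mathcal{M}_{\mathrm{pos}}(\mathcal{S},\mathcal{S}')$ are open subsets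 of $\mathcal{M}_{\mathrm{sym}}(\mathcal{S},\mathcal{S}')$. (iii) $\mathcal{M}_{\mathrm{sym,inv}}(\mathcal{S},\mathcal{S}')$ is a dense subset of $\mathcal{M}_{\mathrm{sym}}(\mathcal{S},\mathcal{S}')$.
   Context: $A\mathcal{S}=\{Ax:x\in\mathcal{S}\}$. $\mathrm{Sym}(n)$, $\mathrm{GL}(n)$, $\mathrm{P}^+(n)$ are respectively the sets of Hermitian, invertible, and Hermitian positive definite matrices in $\mathbb{F}^{n\times n}$. $\mathrm{Sym}(n)$ is a real vector space with its standard smooth structure, and $\mathrm{GL}(n)\cap\mathrm{Sym}(n)$ and $\mathrm{P}^+(n)$ are open submanifolds of it. All sets of matrices carry the subset topology. ''Manifold'' and ''dimension'' refer to real smooth manifolds. *)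

(* Defs.v *)
From HB Require Import structures.
From mathcomp Require Import all_boot all_order all_algebra.
From mathcomp Require Import complex.
From mathcomp Require Import all_classical all_reals all_analysis.

Set Implicit Arguments.
Unset Strict Implicit.
Unset Printing Implicit Defensive.

Import Order.TTheory GRing.Theory Num.Theory.
Import numFieldNormedType.Exports.

Local Open Scope classical_set_scope.
Local Open Scope ring_scope.

(* [Ck U k f]: f is of class C^k on U.  The set U is meant to be open. *)
Fixpoint Ck (R : realType) (V W : normedModType R) (U : set V) (k : nat)
    (f : V -> W) : Prop :=
  if k is k'.+1 then
    (forall x, U x -> differentiable f x) /\
    (forall v : V, Ck U k' (fun x => 'D_v f x))
  else forall x, U x -> {for x, continuous f}.

Definition smooth_on (R : realType) (V W : normedModType R) (U : set V)
    (f : V -> W) : Prop := forall k, Ck U k f.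

(* Smooth manifolds carried by a subset X of a topological space T, X having
   the subset topology.  A smooth structure is given by a smooth atlas, not
   required to be maximal.  Hausdorffness and second countability are not part
   of the definition: below, T is a space of matrices over R or C, and every
   subspace of it has both properties. *)

(* [coord] and [param] are total functions; only the values of [coord] on
   [dom] and of [param] on [cod] are relevant. *)
Record chart (R : realType) (T : topologicalType) (d : nat) := Chart {
  dom : set T;
  cod : set 'rV[R]_d;
  coord : T -> 'rV[R]_d;
  param : 'rV[R]_d -> T }.

Definition relatively_open (T : topologicalType) (X U : set T) : Prop :=
  exists2 O : set T, open O & U = X `&` O.

Definition is_chart (R : realType) (T : topologicalType) (d : nat)
    (X : set T) (c : chart R T d) : Prop :=
  [/\ relatively_open X (dom c) /\ open (cod c),
      (forall x, dom c x -> cod c (coord c x)) /\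
      (forall y, cod c y -> dom c (param c y)),
      (forall x, dom c x -> param c (coord c x) = x) /\
      (forall y, cod c y -> coord c (param c y) = y),
      {within dom c, continuous (coord c)}
    & {within cod c, continuous (param c)}].

(* The coordinate expression, in the charts c and c', of the identity or of an
   inclusion; it is considered on [overlap c c']. *)
Definition overlap (R : realType) (T : topologicalType) (d d' : nat)
    (c : chart R T d) (c' : chart R T d') : set 'rV[R]_d :=
  cod c `&` param c @^-1` dom c'.

Definition transition (R : realType) (T : topologicalType) (d d' : nat)
    (c : chart R T d) (c' : chart R T d') : 'rV[R]_d -> 'rV[R]_d' :=
  coord c' \o param c.

Definition smooth_atlas (R : realType) (T : topologicalType) (d : nat)
    (X : set T) (A : set (chart R T d)) : Prop :=
  [/\ forall c, A c -> is_chart X c,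
      forall x, X x -> exists2 c, A c & dom c x
    & forall c c', A c -> A c' ->
        smooth_on (overlap c c') (transition c c')].

(* M is an embedded submanifold of dimension d of the manifold (X, AX): with
   the subset topology it has a smooth structure of dimension d for which the
   inclusion of M in X is a smooth immersion.  The inclusion is automatically a
   homeomorphism onto its image, as the topology of M is the subset topology. *)
Definition embedded_submanifold (R : realType) (T : topologicalType) (N : nat)
    (X : set T) (AX : set (chart R T N)) (M : set T) (d : nat) : Prop :=
  [/\ smooth_atlas X AX,
      M `<=` X
    & exists2 AM : set (chart R T d), smooth_atlas M AM &
        forall c c', AM c -> AX c' ->
          smooth_on (overlap c c') (transition c c') /\
          (forall y, overlap c c' y -> injective ('d (transition c c') y))].

Inductive scalars := RealScalars | ComplexScalars.

Definition field_of (R : realType) (F : scalars) : numFieldType :=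
  match F with RealScalars => R | ComplexScalars => R[i] end.

Definition of_real (R : realType) (F : scalars) : R -> field_of R F :=
  match F with
  | RealScalars => fun x => x
  | ComplexScalars => fun x => x%:C%C
  end.

Definition conj_of (R : realType) (F : scalars) :
    field_of R F -> field_of R F :=
  match F with
  | RealScalars => fun x => x
  | ComplexScalars => fun z => (z^*)%C
  end.

Definition alpha (F : scalars) : nat :=
  match F with RealScalars => 1 | ComplexScalars => 2 end.

Section Matrices.
Variables (R : realType) (F : scalars) (n : nat).
Local Notation K := (field_of R F).

Definition Sym : set 'M[K]_n :=
  [set A | A \is hermitianmx n false (@conj_of R F)].

Definition GL : set 'M[K]_n := [set A | A \in unitmx].

(* On C, [0 < z] means that z is real and positive. *)
Definition Pos : set 'M[K]_n :=
  [set A | Sym A /\ forall x : 'cV[K]_n, x != 0 ->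
     0 < ((map_mx (@conj_of R F) x)^T *m A *m x) 0 0].

(* The dimension of Sym as a real vector space. *)
Definition sym_dim : nat := (alpha F * (n * (n - 1))./2 + n)%N.

Definition real_linear (N : nat) (f : 'rV[R]_N -> 'M[K]_n) : Prop :=
  forall (a : R) (u v : 'rV[R]_N), f (a *: u + v) = of_real F a *: f u + f v.

(* The standard smooth structure of an open subset X of the real vector space
   Sym: the restrictions to X of all the linear coordinate systems on Sym. *)
Definition sym_atlas (X : set 'M[K]_n) : set (chart R 'M[K]_n sym_dim) :=
  [set c | [/\ real_linear (param c), set_bij setT Sym (param c),
               dom c = X, cod c = param c @^-1` X
             & forall A, X A -> param c (coord c A) = A]].

Variables S S' : {vspace 'cV[K]_n}.

Definition M_sym : set 'M[K]_n :=
  [set A | Sym A /\ (S + linfun (mulmx A) @: S)%VS = S'].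

Definition M_sym_inv : set 'M[K]_n := M_sym `&` GL.

Definition M_pos : set 'M[K]_n := M_sym `&` Pos.

End Matrices.

Arguments Sym {R F n}.
Arguments GL {R F n}.
Arguments Pos {R F n}.

(* Main.v *)
(* M_sym is open in the real linear subspace L = {A in Sym : A S <= S'}, since
   S + A S <= S' holds on L and equality is a condition of maximal rank.  If
   the columns of M form a basis of S and the s = n - p - q rows of Z are the
   equations of S', then A S <= S' means Z A M = 0, and the map A |-> Z A M
   sends Sym onto the s x p matrices, so L has real dimension
   dim Sym - alpha p s.  GL and Pos being open in Sym, M_sym_inv and M_pos are
   open in L, and a single linear chart of L gives their manifold structure;
   all transition maps are restrictions of linear maps.  Density holds because
   A + t I stays in M_sym and is invertible for all but finitely many t. *)
Require Import Defs.
From HB Require Import structures.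
From mathcomp Require Import all_boot all_order all_algebra.
From mathcomp Require Import complex.
From mathcomp Require Import all_classical all_reals all_analysis.
From mathcomp Require Import ring zify.

Set Implicit Arguments.
Unset Strict Implicit.
Unset Printing Implicit Defensive.

Import Order.TTheory GRing.Theory Num.Theory.
Import numFieldNormedType.Exports.

Local Open Scope classical_set_scope.
Local Open Scope ring_scope.

(** * Real and complex scalars *)

Section Scalars.
Variables (R : realType) (F : scalars).
Local Notation K := (field_of R F).

Fact of_real_is_zmod_morphism : zmod_morphism (of_real F : R -> K).
Proof. by case: F => x y; rewrite /= ?rmorphB. Qed.

Fact of_real_is_monoid_morphism : monoid_morphism (of_real F : R -> K).
Proof.
split; first by case: F.
by case: F => x y; rewrite /= ?rmorphM.
Qed.

HB.instance Definition _ := GRing.isZmodMorphism.Build R K (of_real F)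
  of_real_is_zmod_morphism.
HB.instance Definition _ := GRing.isMonoidMorphism.Build R K (of_real F)
  of_real_is_monoid_morphism.

Fact conj_of_is_zmod_morphism : zmod_morphism (@conj_of R F).
Proof. by case: F => x y; rewrite /= ?rmorphB. Qed.

Fact conj_of_is_monoid_morphism : monoid_morphism (@conj_of R F).
Proof.
split; first by case: F; [|exact: conjc1].
by case: F => x y; rewrite /= ?rmorphM.
Qed.

HB.instance Definition _ := GRing.isZmodMorphism.Build K K (@conj_of R F)
  conj_of_is_zmod_morphism.
HB.instance Definition _ := GRing.isMonoidMorphism.Build K K (@conj_of R F)
  conj_of_is_monoid_morphism.

Lemma conj_ofK : involutive (@conj_of R F).
Proof. by case: F => x //=; rewrite conjcK. Qed.

Lemma conj_of_real (a : R) : conj_of (of_real F a) = of_real F a.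
Proof. by case: F => //=; rewrite oppr0. Qed.

Lemma conj_of_fixed (x : K) : conj_of x = x -> x \is Num.real.
Proof.
case: F x => [x _|[a b]] /=; first exact: num_real.
by case=> /eqP; rewrite complex_real -subr_eq0 -opprD oppr_eq0 -mulr2n mulrn_eq0.
Qed.

Lemma real_conj_of (x : K) : x \is Num.real -> conj_of x = x.
Proof.
by case: F x => [|[a b]] //=; rewrite complex_real => /eqP->; rewrite oppr0.
Qed.

Lemma mul_conj_of (x : K) : x * conj_of x = `|x| ^+ 2.
Proof.
case: F x => [x|[a b]] /=; first by rewrite real_normK ?num_real ?expr2.
by rewrite -add_Re2_Im2 /=; simpc; rewrite -!expr2 mulrC addNr.
Qed.

Lemma norm_conj_of (x : K) : `|conj_of x| = `|x|.
Proof.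
by apply/eqP; rewrite -(@eqrXn2 _ 2) // -!mul_conj_of conj_ofK mulrC.
Qed.

Lemma norm_of_real (a : R) : `|of_real F a| = of_real F `|a|.
Proof. by case: F => //=; simpc; rewrite expr0n addr0 sqrtr_sqr. Qed.

Lemma ltr_of_real (a b : R) : (of_real F a < of_real F b) = (a < b).
Proof. by case: F => //=; rewrite ltcR. Qed.

Definition re_of : K -> R :=
  match F return field_of R F -> R with
  | RealScalars => id
  | ComplexScalars => @complex.Re R
  end.

(** A basis of K over R, with [real_coord] as its dual basis. Indexing by ['I_(alpha F)] treats both
    fields alike and turns real dimensions into cardinalities of finite types. *)
Definition real_basis (k : 'I_(alpha F)) : K :=
  (match F return 'I_(alpha F) -> field_of R F with
   | RealScalars => fun=> 1
   | ComplexScalars => fun k => if k == 0 then 1 else 'i%C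
   end) k.

Definition real_coord (k : 'I_(alpha F)) : K -> R :=
  (match F return 'I_(alpha F) -> field_of R F -> R with
   | RealScalars => fun=> id
   | ComplexScalars => fun k => if k == 0 then @complex.Re R else @complex.Im R
   end) k.

Lemma re_ofP (a : R) (x y : K) : re_of (of_real F a * x + y) = a * re_of x + re_of y.
Proof. by rewrite /re_of; case: F x y => //= -[? ?] [? ?]; simpc. Qed.

Lemma re_of_real (a : R) : re_of (of_real F a) = a.
Proof. by rewrite /re_of; case: F. Qed.

Lemma re_of_fixed (x : K) : conj_of x = x -> of_real F (re_of x) = x.
Proof.
move=> /conj_of_fixed; rewrite /re_of; case: F x => [|[a b]] //=.
by rewrite complex_real => /eqP->.
Qed.

Lemma real_coordP k (a : R) (x y : K) :
  real_coord k (of_real F a * x + y) = a * real_coord k x + real_coord k y.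
Proof.
rewrite /real_coord; case: F k x y => //= k [? ?] [? ?].
by case: ifP => _; simpc.
Qed.

Lemma real_coordK (x : K) :
  \sum_k of_real F (real_coord k x) * real_basis k = x.
Proof.
rewrite /real_coord /real_basis.
case: F x => [x|x]; first by rewrite big_ord1 mulr1.
by rewrite big_ord_recl big_ord1 /= mulr1 [RHS]complexE mulrC.
Qed.

Lemma real_coord_sum (c : 'I_(alpha F) -> R) j :
  real_coord j (\sum_k of_real F (c k) * real_basis k) = c j.
Proof.
rewrite /real_coord /real_basis; case: F c j => [c j|c j].
  by rewrite big_ord1 mulr1 (ord1 j).
rewrite big_ord_recl big_ord1 /= mulr1; simpc.
case: eqP => [->|] /=; first by congr c; apply/val_inj.
by case: j => -[|[]]//= ? h; [case: h|]; move=> *; try congr c; apply/val_inj.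
Qed.

End Scalars.

(** * Continuity of the maps between R and K *)

Section ScalarTopology.
Variables (R : realType) (F : scalars).
Local Notation K := (field_of R F).

Lemma re_of_le (x : K) : of_real F `|re_of x| <= `|x|.
Proof.
rewrite /re_of; case: F x => [//|[a b]] /=; rewrite normc_def lecR /=.
by rewrite -sqrtr_sqr ler_wsqrtr // lerDl sqr_ge0.
Qed.

Lemma real_coord_le k (x : K) : of_real F `|real_coord k x| <= `|x|.
Proof.
rewrite /real_coord; case: F k x => [//|k [a b]] /=; rewrite normc_def lecR /=.
by case: ifP => _ /=; rewrite -sqrtr_sqr ler_wsqrtr // ?lerDl ?lerDr sqr_ge0.
Qed.

(** The norm of K takes values in K, so the two norms are compared through [of_real], which
    preserves the strict order. *)
Lemma contraction_continuous (f : K -> R) :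
    (forall x y, f (x - y) = f x - f y) ->
    (forall x, of_real F `|f x| <= `|x|) -> continuous f.
Proof.
move=> fB fle x; have ? := nbhs_filter x; apply/cvgrPdist_lt => e e0.
have e0' : 0 < of_real F e by rewrite -(rmorph0 (of_real F)) ltr_of_real.
near=> y; rewrite -fB -(ltr_of_real F); apply: le_lt_trans (fle _) _.
near: y; exact: (cvgrPdist_lt _ _).1 (@cvg_id _ _) _ _.
Unshelve. all: by end_near. Qed.

Lemma re_of_continuous : continuous (@re_of R F).
Proof.
apply: contraction_continuous; last exact: re_of_le.
move=> x y; have := re_ofP (-1) y x.
by rewrite rmorphN1 !mulN1r addrC => ->; rewrite addrC.
Qed.

Lemma real_coord_continuous k : continuous (@real_coord R F k).
Proof.
apply: contraction_continuous; last exact: real_coord_le.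
move=> x y; have := real_coordP k (-1) y x.
by rewrite rmorphN1 !mulN1r addrC => ->; rewrite addrC.
Qed.

Lemma of_real_continuous : continuous (of_real F : R -> K).
Proof.
move=> a; apply/cvgrPdist_lt => e e0.
(* The radius e lies in K; being positive it is real, hence the image of [re_of e], and the estimate
   takes place in R. *)
have er : conj_of e = e by apply/real_conj_of/gtr0_real.
have e0' : 0 < re_of e.
  by rewrite -(ltr_of_real F) re_of_fixed // rmorph0.
near=> b; rewrite -rmorphB norm_of_real -(re_of_fixed er) ltr_of_real.
near: b; exact: (cvgrPdist_lt _ _).1 (@cvg_id _ _) _ _.
Unshelve. all: by end_near. Qed.

End ScalarTopology.

(** * Smoothness and continuity of linear maps *)

Section AffineMaps.
Variables (R : realType) (V W : normedModType R).

(** Near x the remainder of the first order expansion is exactly zero, so it is a little-o and the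
    differential is L. *)
Lemma near_affine_diff (f : V -> W) (c : W) (L : {linear V -> W}) (x : V) :
    continuous L -> (\forall y \near x, f y = c + L y) ->
  differentiable f x /\ 'd f x = L :> (V -> W).
Proof.
move=> Lc fL.
have fE : f \o shift x = cst (f x) + L +o_ 0 id.
  apply/eqaddoP => e e0.
  have : \forall h \near (0 : V), f (h + x) = c + L (h + x).
    by move: fL; rewrite {1}(near_shift 0) subr0.
  apply: filterS => h /= fh; rewrite !fctE /= fh (nbhs_singleton fL) linearD.
  by rewrite [L h + _]addrC addrA subrr normr0 mulr_ge0 // ltW.
have dE := diff_unique Lc fE; split => //.
by apply/diff_locallyP; rewrite dE.
Unshelve. all: by end_near. Qed.

(** Induction on the order of differentiability, for all affine maps at once: on U the derivative
    along v is the constant L v, which is affine with zero linear part. *)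
Lemma smooth_on_affine (U : set V) (f : V -> W) (c : W) (L : {linear V -> W}) :
    open U -> continuous L -> (forall x, U x -> f x = c + L x) -> smooth_on U f.
Proof.
move=> Uo Lc fL k; elim: k f c L Lc fL => [|k IHk] f c L Lc fL /=.
  move=> x Ux; apply: differentiable_continuous.
  have [] // := @near_affine_diff f c L x Lc.
  by near=> y; apply: fL; near: y; exact: open_nbhs_nbhs.
have fd x : U x -> differentiable f x /\ 'd f x = L :> (V -> W).
  move=> Ux; apply: near_affine_diff Lc _.
  by near=> y; apply: fL; near: y; exact: open_nbhs_nbhs.
split=> [x /fd[]//|v]; apply: (IHk _ (L v) \0%VF).
  exact: cst_continuous.
by move=> x Ux; have [df dL] := fd x Ux; rewrite deriveE // dL addr0.
Unshelve. all: by end_near. Qed.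

End AffineMaps.

(** * Continuity of matrix operations *)

Section MatrixContinuity.
Variables (T : topologicalType) (K : numFieldType).

Lemma mx_continuous (T' : topologicalType) m n (f : T -> 'M[T']_(m, n)) :
  (forall i j, continuous (fun t => f t i j)) -> continuous f.
Proof.
move=> fc t A [P Pt PA]; apply: (filterS PA).
apply: filter_forall => i; apply: filter_forall => j.
exact: fc (Pt i j).
Qed.

Lemma sum_continuous (I : Type) (r : seq I) (P : pred I) (f : I -> T -> K) :
  (forall i, P i -> continuous (f i)) ->
  continuous (fun t => \sum_(i <- r | P i) f i t).
Proof.
move=> fc; elim: r => [|i r IHr].
  by under eq_fun do rewrite big_nil; move=> t; exact: cvg_cst.
have [Pi|Pi] := boolP (P i); under eq_fun do rewrite big_cons ?Pi ?(negbTE Pi) //.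
  move=> t.
  by apply: cvgD; [exact: fc | exact: IHr].
exact: IHr.
Qed.

Lemma prod_continuous (I : Type) (r : seq I) (P : pred I) (f : I -> T -> K) :
  (forall i, P i -> continuous (f i)) ->
  continuous (fun t => \prod_(i <- r | P i) f i t).
Proof.
move=> fc; elim: r => [|i r IHr].
  by under eq_fun do rewrite big_nil; move=> t; exact: cvg_cst.
have [Pi|Pi] := boolP (P i); under eq_fun do rewrite big_cons ?Pi ?(negbTE Pi) //.
  move=> t.
  by apply: cvgM; [exact: fc | exact: IHr].
exact: IHr.
Qed.

Lemma mulmx_continuous m n p (f : T -> 'M[K]_(m, n)) (g : T -> 'M[K]_(n, p)) :
  continuous f -> continuous g -> continuous (fun t => f t *m g t).
Proof.
move=> fc gc; apply: mx_continuous => i j.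
under eq_fun do rewrite mxE.
apply: sum_continuous => k _ t; apply: cvgM.
  exact: (continuous_comp (fc t) (@coord_continuous _ _ _ _ _ _)).
exact: (continuous_comp (gc t) (@coord_continuous _ _ _ _ _ _)).
Qed.

Lemma row_mx_continuous m n p (f : T -> 'M[K]_(m, n)) (g : T -> 'M[K]_(m, p)) :
  continuous f -> continuous g -> continuous (fun t => row_mx (f t) (g t)).
Proof.
move=> fc gc; apply: mx_continuous => i j; case: (fintype.splitP j) => k jk.
  have -> : j = lshift _ k by apply/val_inj.
  under eq_fun do rewrite row_mxEl.
  move=> t; exact: (continuous_comp (fc t) (@coord_continuous _ _ _ _ _ _)).
have -> : j = rshift _ k by apply/val_inj.
under eq_fun do rewrite row_mxEr.
move=> t; exact: (continuous_comp (gc t) (@coord_continuous _ _ _ _ _ _)).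
Qed.

Lemma det_continuous n (f : T -> 'M[K]_n) :
  continuous f -> continuous (fun t => \det (f t)).
Proof.
move=> fc; apply: sum_continuous => s _ t; apply: cvgM; first exact: cvg_cst.
apply: prod_continuous => i _ {}t.
exact: (continuous_comp (fc t) (@coord_continuous _ _ _ _ _ _)).
Qed.

End MatrixContinuity.

Lemma linear_rV_continuous (R : realType) m n (L : {linear 'rV[R]_m -> 'rV[R]_n}) :
  continuous L.
Proof.
have -> : (L : _ -> _) = (fun u => u *m lin1_mx L).
  by apply/funext => u; rewrite mul_rV_lin1.
apply: mulmx_continuous => u; first exact: cvg_id.
by have ? := nbhs_filter u; exact: cvg_cst.
Qed.

(** * Real linear maps into matrices over K *)

Section RealLinear.
Variables (R : realType) (F : scalars) (n N : nat).
Local Notation K := (field_of R F).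
Variables (phi : 'rV[R]_N -> 'M[K]_n) (phiL : real_linear phi).

Lemma real_linear0 : phi 0 = 0.
Proof.
by have := phiL (-1) 0 0; rewrite scaler0 add0r rmorphN1 scaleN1r addNr.
Qed.

Lemma real_linear_sum (I : Type) (r : seq I) (a : I -> R) (v : I -> 'rV[R]_N) :
  phi (\sum_(i <- r) a i *: v i) = \sum_(i <- r) of_real F (a i) *: phi (v i).
Proof.
elim/big_rec2: _ => [|i y x _ <-]; [exact: real_linear0 | exact: phiL].
Qed.

Lemma real_linearE (u : 'rV[R]_N) :
  phi u = \sum_j of_real F (u 0 j) *: phi (delta_mx 0 j).
Proof. by rewrite {1}(row_sum_delta u) real_linear_sum. Qed.

Lemma real_linear_continuous : continuous phi.
Proof.
apply: mx_continuous => i j.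
under eq_fun do rewrite real_linearE summxE.
apply: sum_continuous => k _ u; under eq_fun do rewrite mxE.
have ? := nbhs_filter u; apply: cvgM; last exact: cvg_cst.
exact: (continuous_comp (@coord_continuous _ _ _ _ _ _) (@of_real_continuous _ _ _)).
Qed.

End RealLinear.

(** * Submanifolds that are open in a real linear subspace of Sym *)

Section LinearCharts.
Variables (R : realType) (F : scalars) (n : nat).
Local Notation K := (field_of R F).
Implicit Types (L X M : set 'M[K]_n).

(** A real linear isomorphism phi from R^d onto L, whose inverse is extended to a continuous real
    linear map psi on all matrices. Continuity of psi within any subset is then immediate. *)
Record linear_coordinates L (d : nat) (phi : 'rV[R]_d -> 'M[K]_n)
    (psi : 'M[K]_n -> 'rV[R]_d) : Prop := LinearCoordinates {
  lc_linear : real_linear phi;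
  lc_in : forall u, L (phi u);
  lc_continuous : continuous psi;
  lc_real : forall (a : R) (A B : 'M[K]_n),
    psi (of_real F a *: A + B) = a *: psi A + psi B;
  lc_phiK : cancel phi psi;
  lc_psiK : forall A, L A -> phi (psi A) = A }.

Lemma relatively_open_refl (T : topologicalType) (X : set T) : relatively_open X X.
Proof. by exists setT; rewrite ?setIT //; exact: openT. Qed.

(** As phi takes its values in L, the preimage of L [&] U is that of the open set U. *)
Lemma open_preimage_linear L X d (phi : 'rV[R]_d -> 'M[K]_n) :
  real_linear phi -> (forall u, L (phi u)) -> relatively_open L X ->
  open (phi @^-1` X).
Proof.
move=> phiL Lphi [U Uo ->]; rewrite (_ : _ @^-1` _ = phi @^-1` U).
  by apply: open_comp => // u _; exact: real_linear_continuous.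
by apply/seteqP; split=> [u []|u].
Qed.

Lemma is_chart_linear L M d (phi : 'rV[R]_d -> 'M[K]_n) psi :
  linear_coordinates L phi psi -> relatively_open L M ->
  is_chart M (Chart M (phi @^-1` M) psi phi).
Proof.
move=> lc LM; have ML : M `<=` L by case: LM => O _ ->; exact: subIsetl.
have MphiK A : M A -> phi (psi A) = A by move/ML; exact: (lc_psiK lc).
split=> /=.
- split; first exact: relatively_open_refl.
  exact: (open_preimage_linear (lc_linear lc) (lc_in lc) LM).
- by split=> // A MA; rewrite /preimage /= MphiK.
- by split=> // u _; exact: (lc_phiK lc u).
- by apply: continuous_subspaceT; exact: (lc_continuous lc).
- by apply: continuous_subspaceT; apply: (real_linear_continuous (lc_linear lc)).
Qed.

(** Since [param c] is a real linear bijection onto Sym, phi factors through it by a linear map g,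
    whose matrix has as rows the preimages of the phi(e_j). The values of [coord c] are controlled
    on X only, whence the guard in the last clause. *)
Lemma sym_atlas_factor X (c : chart R 'M[K]_n (sym_dim F n)) d
    (phi : 'rV[R]_d -> 'M[K]_n) :
    sym_atlas X c -> real_linear phi -> injective phi -> (forall u, Sym (phi u)) ->
  exists g : {linear 'rV[R]_d -> 'rV[R]_(sym_dim F n)},
    [/\ injective g, forall u, param c (g u) = phi u &
        forall u, X (phi u) -> Defs.coord c (phi u) = g u].
Proof.
move=> [cL [_ cinj csurj] _ _ cK] phiL phiI Sphi.
have /choice[r rE] (j : 'I_d) : exists v, param c v = phi (delta_mx 0 j).
  by have [v _ <-] := csurj _ (Sphi (delta_mx 0 j)); exists v.
have gE u : param c (mulmxr (\matrix_j r j) u) = phi u.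
  rewrite /= mulmx_sum_row real_linear_sum // [RHS]real_linearE //.
  by apply: eq_bigr => j _; rewrite rowK rE.
exists (mulmxr (\matrix_j r j)); split=> // [u v uv|u Xu].
  by apply: phiI; rewrite -!gE uv.
by apply: cinj; rewrite ?in_setT // cK // gE.
Qed.

Section Submanifold.
Variables (phi0 : 'rV[R]_(sym_dim F n) -> 'M[K]_n).
Variables (psi0 : 'M[K]_n -> 'rV[R]_(sym_dim F n)).
Hypothesis lc0 : linear_coordinates Sym phi0 psi0.

Lemma sym_atlas_is_chart X c :
  relatively_open Sym X -> sym_atlas X c -> is_chart X c.
Proof.
move=> SX cX; have XS : X `<=` Sym by case: SX => O _ ->; exact: subIsetl.
have [g [_ _ gE]] :=
  sym_atlas_factor cX (lc_linear lc0) (can_inj (lc_phiK lc0)) (lc_in lc0).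
case: cX => cL [cS cinj _] cdom ccod cK.
split; rewrite ?cdom ?ccod.
- split; first exact: relatively_open_refl.
  by apply: (open_preimage_linear cL _ SX) => u; exact: cS.
- by split=> // A XA; rewrite /preimage /= cK.
- by split=> // u Xu; apply: cinj; rewrite ?in_setT // cK.
(* On X the coordinate map agrees with g \o psi0, which is continuous everywhere. *)
- apply: (@subspace_eq_continuous _ _ _ (g \o psi0)); last first.
    apply: continuous_subspaceT => A; apply: continuous_comp.
      exact: (lc_continuous lc0).
    exact: linear_rV_continuous.
  by move=> A /set_mem XA /=; rewrite -gE (lc_psiK lc0 (XS _ XA)).
- by apply: continuous_subspaceT; apply: (real_linear_continuous cL).
Qed.

(** The chart made of phi0 and psi0 covers X. Two charts differ by a linear map, namely the factor g
    obtained from the parametrization of the first. *)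
Lemma sym_atlas_smooth X : relatively_open Sym X -> smooth_atlas X (sym_atlas X).
Proof.
move=> SX; have XS : X `<=` Sym by case: SX => O _ ->; exact: subIsetl.
split=> [c|A XA|c c' cX cX'].
- exact: sym_atlas_is_chart.
- exists (Chart X (phi0 @^-1` X) psi0 phi0) => //; split=> //=.
  + exact: (lc_linear lc0).
  + split=> [u _|u v _ _|B SB]; first exact: (lc_in lc0 u).
      exact: (can_inj (lc_phiK lc0)).
    by exists (psi0 B) => //; exact: (lc_psiK lc0 SB).
  + by move=> B /XS; exact: (lc_psiK lc0).
- have := cX; case=> cL [cS cinj csurj] cdom ccod cK.
  have ci : injective (param c) by move=> u v uv; apply: cinj; rewrite ?in_setT.
  have Sc u : Sym (param c u) by apply: cS.
  have [g [_ _ gE]] := sym_atlas_factor cX' cL ci Sc.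
  have Xo : open (param c @^-1` X) := open_preimage_linear cL Sc SX.
  have dom' : dom c' = X by case: cX'.
  apply: (@smooth_on_affine _ _ _ _ _ 0 g).
  + by rewrite /overlap ccod dom'; exact: openI.
  + exact: linear_rV_continuous.
  + by move=> u []; rewrite ccod => Xu _; rewrite add0r /transition /= gE.
Qed.

(** One chart, phi and psi restricted to M, is an atlas of M whose only transition is the identity.
    Against a chart of X the inclusion reads as an injective linear map g, which is its own
    differential, hence a smooth immersion. *)
Lemma embedded_linear X M L d (phi : 'rV[R]_d -> 'M[K]_n) psi :
    relatively_open Sym X -> L `<=` Sym -> linear_coordinates L phi psi ->
    relatively_open L M -> M `<=` X ->
  embedded_submanifold X (sym_atlas X) M d.
Proof.
move=> SX LS lc LM MX; split=> //; first exact: sym_atlas_smooth.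
pose c := Chart M (phi @^-1` M) psi phi.
have phiL := lc_linear lc.
have Mo : open (phi @^-1` M) := open_preimage_linear phiL (lc_in lc) LM.
have Sphi u : Sym (phi u) by apply/LS; exact: (lc_in lc u).
have Xo : open (phi @^-1` X) := open_preimage_linear phiL Sphi SX.
exists [set c].
  split=> [e ->|A MA|e e' -> ->]; first exact: (is_chart_linear lc LM).
    by exists c.
  apply: (@smooth_on_affine _ _ _ _ _ 0 idfun).
  - exact: openI.
  - by move=> u; exact: cvg_id.
  - by move=> u _; rewrite add0r /transition /= (lc_phiK lc).
move=> e c' -> cX {e}.
have [g [gI _ gE]] := sym_atlas_factor cX phiL (can_inj (lc_phiK lc)) Sphi.
have gc : continuous g by exact: linear_rV_continuous.
have dom' : dom c' = X by case: cX.
have oo : open (overlap c c') by rewrite /overlap dom' /=; exact: openI.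
have tE u : overlap c c' u -> transition c c' u = 0 + g u.
  by rewrite /overlap dom' => -[_ Xu]; rewrite add0r /transition /= gE.
split; first exact: (smooth_on_affine oo gc tE).
move=> u ou; have [|_ ->//] := @near_affine_diff _ _ _ (transition c c') 0 g u gc.
by near=> v; apply: tE; near: v; exact: open_nbhs_nbhs.
Unshelve. all: by end_near. Qed.

End Submanifold.
End LinearCharts.

(** * Linear coordinates on Sym and on its subspaces *)

Section SymCoordinates.
Variables (R : realType) (F : scalars) (n : nat).
Local Notation K := (field_of R F).

Lemma SymP (A : 'M[K]_n) : Sym A <-> forall i j, A i j = conj_of (A j i).
Proof.
split=> [/is_hermitianmxP AE i j|AE].
  by rewrite {1}AE expr0 scale1r !mxE.
by apply/is_hermitianmxP/matrixP => i j; rewrite expr0 scale1r !mxE.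
Qed.

(** The free real parameters of a Hermitian matrix: one for each diagonal entry, which is real, and
    [alpha F] for each entry strictly above the diagonal. *)
Local Notation upper := {ij : 'I_n * 'I_n | (ij.1 < ij.2)%N}.
Local Notation index := ('I_n + upper * 'I_(alpha F))%type.

(** Counting by columns: column j contains j pairs, and the j < n add up to the binomial coefficient
    of n over 2. *)
Lemma card_upper : #|{: upper}| = ((n * (n - 1))./2)%N.
Proof.
rewrite card_sig -sum1_card subn1 -bin2 -bin2_sum big_mkord.
transitivity (\sum_(j < n) \sum_(i < n | (i < j)%N) 1)%N.
  rewrite [RHS](exchange_big_dep xpredT) //= pair_big_dep /=.
  by apply: eq_bigl => -[i j]; rewrite !inE.
apply: eq_bigr => j _; rewrite (big_ord_narrow (ltnW (ltn_ord j))) sum_nat_const.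
by rewrite card_ord muln1.
Qed.

Lemma card_sym_index : #|{: index}| = sym_dim F n.
Proof.
by rewrite card_sum card_prod !card_ord card_upper /sym_dim mulnC addnC.
Qed.

(** [insub] casts (i, j) into the type of pairs above the diagonal. [herm_of] swaps the indices when
    needed, so the default 0 never becomes an entry. *)
Definition upper_entry (u : index -> R) (i j : 'I_n) : K :=
  if insub (i, j) is Some s
  then \sum_k of_real F (u (inr (s, k))) * @real_basis R F k else 0.

Definition herm_of (u : index -> R) : 'M[K]_n :=
  \matrix_(i, j) if i == j then of_real F (u (inl i)) else
    if (i < j)%N then upper_entry u i j else conj_of (upper_entry u j i).

Definition herm_coord (A : 'M[K]_n) (t : index) : R :=
  match t with
  | inl i => re_of (A i i)
  | inr (s, k) => real_coord k (A (val s).1 (val s).2)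
  end.

Lemma upper_entryP (a : R) (u v : index -> R) i j :
  upper_entry (fun t => a * u t + v t) i j =
  of_real F a * upper_entry u i j + upper_entry v i j.
Proof.
rewrite /upper_entry; case: insubP => [s _ _|_]; last by rewrite mulr0 addr0.
rewrite mulr_sumr -big_split /=; apply: eq_bigr => k _.
by rewrite rmorphD rmorphM mulrDl mulrA.
Qed.

Lemma herm_ofP (a : R) (u v : index -> R) :
  herm_of (fun t => a * u t + v t) = of_real F a *: herm_of u + herm_of v.
Proof.
apply/matrixP => i j; rewrite !mxE; case: ifP => _.
  by rewrite rmorphD rmorphM.
case: ifP => _; rewrite upper_entryP //.
by rewrite rmorphD rmorphM /= conj_of_real.
Qed.

Lemma Sym_herm_of (u : index -> R) : Sym (herm_of u).
Proof.
apply/SymP => i j; rewrite !mxE (eq_sym j i).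
case: eqVneq => [->|ij]; first by rewrite conj_of_real.
case: (ltngtP i j) => [||/val_inj eij]; rewrite ?conj_ofK //.
by rewrite eij eqxx in ij.
Qed.

Lemma herm_ofK (u : index -> R) : herm_coord (herm_of u) = u.
Proof.
apply/funext => -[i|[s k]] /=; rewrite mxE; first by rewrite eqxx re_of_real.
have := valP s; rewrite /= => sP; rewrite sP.
case: eqP => [e|_]; first by rewrite e ltnn in sP.
rewrite /upper_entry -surjective_pairing valK.
by rewrite real_coord_sum.
Qed.

Lemma herm_coordK (A : 'M[K]_n) : Sym A -> herm_of (herm_coord A) = A.
Proof.
move=> /SymP AE; have upE (i j : 'I_n) : (i < j)%N -> upper_entry (herm_coord A) i j = A i j.
  move=> ij; rewrite /upper_entry; case: insubP => [s _ sE|]; last by rewrite /= ij.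
  by rewrite /= sE real_coordK.
apply/matrixP => i j; rewrite mxE; case: eqVneq => [->|ij].
  by rewrite /= re_of_fixed // -AE.
case: (ltngtP i j) => [/upE//|/upE->|/val_inj eij]; first by rewrite -AE.
by rewrite eij eqxx in ij.
Qed.

Lemma herm_coordP (a : R) (A B : 'M[K]_n) t :
  herm_coord (of_real F a *: A + B) t = a * herm_coord A t + herm_coord B t.
Proof. by case: t => [i|[s k]] /=; rewrite !mxE ?re_ofP ?real_coordP. Qed.

Lemma herm_coord_continuous t : continuous (herm_coord ^~ t).
Proof.
case: t => [i|[s k]] A; apply: continuous_comp; try exact: coord_continuous.
  exact: re_of_continuous.
exact: real_coord_continuous.
Qed.

Lemma Sym_linear_coordinates :
  exists phi psi, @linear_coordinates R F n Sym (sym_dim F n) phi psi.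
Proof.
(* With the dimension written as a cardinality, [enum_rank] and [enum_val] number the
   coordinates. *)
rewrite -card_sym_index.
exists (fun u => herm_of (fun t => u 0 (enum_rank t))).
exists (fun A => \row_t herm_coord A (enum_val t)); split.
- by move=> a u v; rewrite -herm_ofP; congr herm_of; apply/funext => t; rewrite !mxE.
- by move=> u; exact: Sym_herm_of.
- apply: mx_continuous => i j; under eq_fun do rewrite mxE.
  exact: herm_coord_continuous.
- by move=> a A B; apply/rowP => t; rewrite !mxE herm_coordP.
- by move=> u; apply/rowP => t; rewrite mxE herm_ofK enum_valK.
- move=> A SA; rewrite -[RHS]herm_coordK //; congr herm_of.
  by apply/funext => t; rewrite mxE enum_rankK.
Qed.

End SymCoordinates.

(** * Coordinates on the kernel of a surjective linear map *)

Section KernelCoordinates.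
Variables (R : realType) (F : scalars) (n a b N : nat).
Local Notation K := (field_of R F).
Local Notation index := (('I_a * 'I_b) * 'I_(alpha F))%type.

Definition entry_coord (M : 'M[K]_(a, b)) (t : index) : R :=
  real_coord t.2 (M t.1.1 t.1.2).

Lemma entry_coordP (c : R) (A B : 'M[K]_(a, b)) t :
  entry_coord (of_real F c *: A + B) t = c * entry_coord A t + entry_coord B t.
Proof. by rewrite /entry_coord !mxE real_coordP. Qed.

Lemma entry_coord0 t : entry_coord 0 t = 0.
Proof.
by have := entry_coordP (-1) 0 0 t; rewrite scaler0 add0r mulN1r addNr.
Qed.

Lemma entry_coord_surj (c : index -> R) :
  exists M : 'M[K]_(a, b), entry_coord M = c.
Proof.
exists (\matrix_(i, j) \sum_k of_real F (c (i, j, k)) * @real_basis R F k).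
by apply/funext => -[[i j] k]; rewrite /entry_coord mxE real_coord_sum.
Qed.

Lemma entry_coord_eq0 (M : 'M[K]_(a, b)) :
  (forall t, entry_coord M t = 0) -> M = 0.
Proof.
move=> M0; apply/matrixP => i j; rewrite mxE -[LHS]real_coordK big1 // => k _.
by have := M0 (i, j, k); rewrite /entry_coord /= => ->; rewrite rmorph0 mul0r.
Qed.

(** In real coordinates f \o phi0 is right multiplication by a matrix G, of rank alpha a b because f
    maps L onto all matrices. A basis B of the left kernel of G then has d rows and parametrizes the
    subspace. *)
Lemma kernel_linear_coordinates (L : set 'M[K]_n) (phi0 : 'rV[R]_N -> 'M[K]_n)
    (psi0 : 'M[K]_n -> 'rV[R]_N) (f : {linear 'M[K]_n -> 'M[K]_(a, b)}) d :
    linear_coordinates L phi0 psi0 ->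
    (forall M, exists2 A, L A & f A = M) ->
    (d + alpha F * (a * b))%N = N ->
  exists phi psi, @linear_coordinates R F n [set A | L A /\ f A = 0] d phi psi.
Proof.
move=> lc fsurj dN.
have phiL := lc_linear lc.
pose g u := \row_(t < #|{: index}|) entry_coord (f (phi0 u)) (enum_val t).
pose G := \matrix_j g (delta_mx 0 j).
have gE u : u *m G = g u.
  apply/rowP => t; rewrite mulmx_sum_row summxE mxE.
  have -> : f (phi0 u) = \sum_j of_real F (u 0 j) *: f (phi0 (delta_mx 0 j)).
    by rewrite (real_linearE phiL) linear_sum; apply: eq_bigr => j _; rewrite linearZ.
  have -> : entry_coord (\sum_j of_real F (u 0 j) *: f (phi0 (delta_mx 0 j)))
      (enum_val t) = \sum_j u 0 j * entry_coord (f (phi0 (delta_mx 0 j))) (enum_val t).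
    by elim/big_rec2: _ => [|j x y _ <-]; rewrite ?entry_coord0 ?entry_coordP.
  by apply: eq_bigr => j _; rewrite !mxE.
(* Every unit row vector is the coordinate vector of some matrix, hence of f A for some A in L, so G
   has full row space. *)
have Grank : \rank G = (alpha F * (a * b))%N.
  have -> : (alpha F * (a * b))%N = #|{: index}| by rewrite !card_prod !card_ord mulnC.
  apply/eqP; rewrite -[_ == _]/(row_full G) -sub1mx; apply/row_subP => i.
  have [M ME] := entry_coord_surj (fun t => (row i 1%:M : 'rV[R]_ _) 0 (enum_rank t)).
  have [A LA fA] := fsurj M; apply/submxP; exists (psi0 A); rewrite gE.
  by apply/rowP => t; rewrite [RHS]mxE (lc_psiK lc LA) fA ME enum_valK.
have dE : \rank (kermx G) = d by rewrite mxrank_ker Grank -dN addnK.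
(* Replacing d by the rank of the kernel gives [row_base] the required number of rows. *)
case: _ / dE.
pose B := row_base (kermx G).
have BG : B *m G = 0 by apply/sub_kermxP; rewrite eq_row_base.
(* As B has independent rows, [pinvmx B] is a right inverse of B; on the row space of B, multiplying
   by [pinvmx B] and then by B is the identity. *)
exists (fun v => phi0 (v *m B)), (fun A => psi0 A *m pinvmx B); split.
- by move=> c u v; rewrite mulmxDl -scalemxAl phiL.
- move=> v; split; first exact: (lc_in lc).
  apply: entry_coord_eq0 => t; have := gE (v *m B).
  by rewrite -mulmxA BG mulmx0 => /rowP/(_ (enum_rank t)); rewrite !mxE enum_rankK.
- apply: mulmx_continuous; first exact: (lc_continuous lc).
  by move=> A; have ? := nbhs_filter A; exact: cvg_cst.
- by move=> c A1 A2; rewrite (lc_real lc) mulmxDl -scalemxAl.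
- by move=> v; rewrite (lc_phiK lc) mulmxKp // row_base_free.
- move=> A [LA fA0]; rewrite mulmxKpV ?(lc_psiK lc) // eq_row_base.
  apply/sub_kermxP; rewrite gE; apply/rowP => t.
  by rewrite !mxE (lc_psiK lc LA) fA0 entry_coord0.
Qed.

End KernelCoordinates.

(** * Bases and equations of subspaces in matrix form *)

Section SubspaceMatrices.
Variables (K : fieldType) (n : nat).
Implicit Types S : {vspace 'cV[K]_n}.

(** The columns of M form a basis of S; the left inverse expresses their independence. *)
Lemma vspace_basis_mx S : exists M : 'M[K]_(n, \dim S),
  (forall x, x \in S <-> exists u, x = M *m u) /\ exists M', M' *m M = 1%:M.
Proof.
pose M := \matrix_(i < n, j < \dim S) (vbasis S)`_j i 0.
have ME u : M *m u = \sum_j u j 0 *: (vbasis S)`_j.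
  apply/colP => i; rewrite mxE summxE; apply: eq_bigr => j _.
  by rewrite !mxE mulrC.
exists M; split=> [x|].
  split=> [xS|[u ->]]; last first.
    by rewrite ME memv_suml // => j _; rewrite memvZ // vbasis_mem // mem_nth // size_tuple.
  exists (\col_j vector.coord (vbasis S) j x); rewrite ME [LHS](coord_vbasis xS).
  by apply: eq_bigr => j _; rewrite mxE.
suff /row_freeP[B MB] : row_free M^T.
  by exists B^T; rewrite -[M]trmxK -trmx_mul MB trmx1.
apply: inj_row_free => v vM; apply/rowP => j; rewrite mxE.
have /freeP/(_ (fun j => v 0 j)) := basis_free (vbasisP S); apply.
transitivity (M *m v^T); last by rewrite -[M]trmxK -trmx_mul vM trmx0.
by rewrite ME; apply: eq_bigr => k _; rewrite mxE.
Qed.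

(** If the columns of M form a basis of S, the cokernel C of M^T satisfies x^T C = 0 exactly for x
    in S. A basis of the column space of C, transposed, keeps n - dim S independent equations. *)
Lemma vspace_equations_mx S : exists Z : 'M[K]_(n - \dim S, n),
  (forall x, x \in S <-> Z *m x = 0) /\ exists Z', Z *m Z' = 1%:M.
Proof.
have [M [MS [M' M'M]]] := vspace_basis_mx S.
have Mrank : \rank M^T = \dim S.
  apply/eqP; rewrite -[_ == _]/(row_free M^T); apply/row_freeP; exists M'^T.
  by rewrite -trmx_mul M'M trmx1.
pose C := cokermx M^T.
have Crank : \rank C = (n - \dim S)%N by rewrite mxrank_coker Mrank.
have xC (x : 'cV_n) : x \in S <-> x^T *m C = 0.
  split=> [/MS[u ->]|/eqP]; first by rewrite trmx_mul -mulmxA mulmx_coker mulmx0.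
  rewrite -submxE => /submxP[D xD]; apply/MS; exists D^T.
  by rewrite -[LHS]trmxK xD trmx_mul trmxK.
case: _ / Crank; exists (col_base C)^T; split=> [x|]; last first.
  have /row_fullP[B BC] := col_base_full C; exists B^T.
  by rewrite -trmx_mul BC trmx1.
rewrite xC; split=> [xC0|Cx0].
  apply: trmx_inj; rewrite trmx_mul trmxK trmx0.
  have /row_freeP[B CB] := row_base_free C.
  by rewrite -[LHS]mulmx1 -CB mulmxA -[_ *m _ *m row_base C]mulmxA mulmx_base xC0 mul0mx.
by rewrite -[C]mulmx_base mulmxA -[col_base C]trmxK -trmx_mul Cx0 trmx0 mul0mx.
Qed.

Lemma col_factor m p q (M : 'M[K]_(m, p)) (N : 'M[K]_(m, q)) :
  (forall u : 'cV_p, exists w, M *m u = N *m w) -> exists W, M = N *m W.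
Proof.
move=> MN; have /choice[w wE] (j : 'I_p) : exists w, col j M = N *m w.
  by have [w wE] := MN (delta_mx j 0); exists w; rewrite colE.
exists (\matrix_(i, j) w j i 0); apply/matrixP => i j.
have /colP/(_ i) := wE j; rewrite !mxE => ->.
by apply: eq_bigr => k _; rewrite mxE.
Qed.

(** Turns S + A S into the column space of [M, A M], on which determinants can act. *)
Lemma memv_add_image S (A : 'M[K]_n) p (M : 'M[K]_(n, p)) x :
    (forall x, x \in S <-> exists u, x = M *m u) ->
  x \in (S + linfun (mulmx A) @: S)%VS <->
  exists w, x = row_mx M (A *m M) *m w.
Proof.
move=> MS; split=> [/memv_addP[y /MS[u ->] [_ /memv_imgP[z /MS[v ->] ->] ->]]|[w ->]].
  by exists (col_mx u v); rewrite mul_row_col lfunE /= mulmxA.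
rewrite -[w]vsubmxK mul_row_col -mulmxA.
apply: memv_add; first by apply/MS; exists (usubmx w).
apply/memv_imgP; exists (M *m dsubmx w); first by apply/MS; exists (dsubmx w).
by rewrite lfunE.
Qed.

(** For x in S, (A + t I) x = A x + t x and t x stays in S. *)
Lemma sub_add_image_shift S (A : 'M[K]_n) (t : K) :
  (S + linfun (mulmx (A + t%:M)) @: S <= S + linfun (mulmx A) @: S)%VS.
Proof.
rewrite subv_add addvSl; apply/subvP => _ /memv_imgP[x xS ->].
rewrite lfunE /= mulmxDl mul_scalar_mx addrC memv_add ?memvZ //.
by apply/memv_imgP; exists x; rewrite ?lfunE.
Qed.

(** The reverse inclusion is the previous one for A + t I and -t. *)
Lemma add_image_shift S (A : 'M[K]_n) (t : K) :
  (S + linfun (mulmx (A + t%:M)) @: S)%VS = (S + linfun (mulmx A) @: S)%VS.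
Proof.
apply/eqP; rewrite eqEsubv sub_add_image_shift /=.
rewrite -{1}[A](addrK t%:M) -raddfN; exact: sub_add_image_shift.
Qed.

End SubspaceMatrices.

(** * Adjoints, and the Hermitian matrices mapping S into S' *)

Section HermitianSubspace.
Variables (R : realType) (F : scalars).
Local Notation K := (field_of R F).

Definition adj m n (A : 'M[K]_(m, n)) : 'M[K]_(n, m) := (map_mx (@conj_of R F) A)^T.

Lemma adjK m n : cancel (@adj m n) (@adj n m).
Proof. by move=> A; apply/matrixP => i j; rewrite !mxE conj_ofK. Qed.

Lemma adjM m n p (A : 'M[K]_(m, n)) (B : 'M[K]_(n, p)) : adj (A *m B) = adj B *m adj A.
Proof. by rewrite /adj map_mxM trmx_mul. Qed.

Lemma adjD m n (A B : 'M[K]_(m, n)) : adj (A + B) = adj A + adj B.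
Proof. by rewrite /adj map_mxD linearD. Qed.

Lemma adj0 m n : adj (0 : 'M[K]_(m, n)) = 0.
Proof. by rewrite /adj map_mx0 trmx0. Qed.

Lemma Sym_adj n (A : 'M[K]_n) : Sym A <-> adj A = A.
Proof.
rewrite SymP; split=> [AE|AE i j]; last by rewrite -{1}AE !mxE.
by apply/matrixP => i j; rewrite !mxE -AE.
Qed.

(** The only entry of x^* x is the sum of the nonnegative |x_i|^2. *)
Lemma adj_mul_eq0 n (x : 'cV[K]_n) : adj x *m x = 0 -> x = 0.
Proof.
move=> /matrixP/(_ 0 0); rewrite !mxE => /eqP.
rewrite (eq_bigr (fun i => `|x i 0| ^+ 2)) => [|i _]; last first.
  by rewrite !mxE mulrC mul_conj_of.
rewrite psumr_eq0 => [/allP x0|i _]; last exact: exprn_ge0.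
apply/colP => i; rewrite mxE; have /implyP/(_ isT) := x0 i (mem_index_enum i).
by rewrite sqrf_eq0 normr_eq0 => /eqP.
Qed.

(** If v M^* M = 0, the vector M v^* has norm zero, so it vanishes, and the left inverse of M gives
    v = 0. *)
Lemma gram_unitmx n p (M : 'M[K]_(n, p)) M' :
  M' *m M = 1%:M -> adj M *m M \in unitmx.
Proof.
move=> M'M; rewrite -row_free_unit; apply: inj_row_free => v vM.
have Mv : M *m adj v = 0.
  apply: adj_mul_eq0; rewrite adjM adjK -mulmxA; move: vM; rewrite mulmxA.
  by rewrite !mulmxA => ->; rewrite mul0mx.
by rewrite -[v]adjK -[adj v]mul1mx -M'M -mulmxA Mv mulmx0 adj0.
Qed.

(* With P = (M^* M)^-1 M^* the adjoint of C = Z' T P is killed by Z, so that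
   Z (C + C^* ) M = Z C M = T. *)
Lemma Sym_compression_surj n p s (M : 'M[K]_(n, p)) M' (Z : 'M[K]_(s, n)) Z' :
    M' *m M = 1%:M -> Z *m Z' = 1%:M -> Z *m M = 0 ->
  forall T, exists2 A, Sym A & Z *m A *m M = T.
Proof.
move=> M'M ZZ' ZM T; have Gu := gram_unitmx M'M.
pose C := Z' *m T *m (invmx (adj M *m M) *m adj M).
exists (C + adj C); first by apply/Sym_adj; rewrite adjD adjK addrC.
rewrite mulmxDr mulmxDl.
have -> : Z *m C *m M = T.
  by rewrite /C !mulmxA ZZ' mul1mx -!mulmxA mulVmx // mulmx1.
by rewrite /C !adjM adjK !mulmxA ZM !mul0mx addr0.
Qed.

Lemma M_sym_sub_coordinates n (S S' : {vspace 'cV[K]_n}) d :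
    (S <= S')%VS -> (d + alpha F * (\dim S * (n - \dim S')))%N = sym_dim F n ->
  exists phi psi, @linear_coordinates R F n
    [set A | Sym A /\ (linfun (mulmx A) @: S <= S')%VS] d phi psi.
Proof.
move=> SS' dE.
have [M [MS [M' M'M]]] := vspace_basis_mx S.
have [Z [ZS [Z' ZZ']]] := vspace_equations_mx S'.
(* Here S <= S' enters: it makes Z kill the adjoint part in [Sym_compression_surj]. *)
have ZM : Z *m M = 0.
  apply/matrixP => i j; rewrite [RHS]mxE.
  have /ZS/colP/(_ i) : col j M \in S'.
    by apply/(subvP SS')/MS; exists (delta_mx j 0); rewrite colE.
  by rewrite colE mulmxA -colE !mxE.
have [phi0 [psi0 lc0]] := Sym_linear_coordinates R F n.
pose f : {linear 'M[K]_n -> 'M[K]_(n - \dim S', \dim S)} := mulmxr M \o mulmx Z.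
have fsurj := Sym_compression_surj M'M ZZ' ZM : forall T, exists2 A, Sym A & f A = T.
rewrite (mulnC (\dim S)) in dE.
have [phi [psi lc]] := kernel_linear_coordinates lc0 fsurj dE.
exists phi, psi; rewrite (_ : mkset _ = [set A | Sym A /\ f A = 0]) //.
apply/seteqP; split=> A [SA]; rewrite /f /= => AS; split=> //.
  apply/matrixP => i j; rewrite [RHS]mxE.
  have /ZS/colP/(_ i) : A *m col j M \in S'.
    apply/(subvP AS)/memv_imgP; exists (col j M); last by rewrite lfunE.
    by apply/MS; exists (delta_mx j 0); rewrite colE.
  by rewrite colE !mulmxA -colE !mxE.
apply/subvP => _ /memv_imgP[x /MS[u ->] ->]; rewrite lfunE /=.
by apply/ZS; rewrite !mulmxA AS mul0mx.
Qed.

End HermitianSubspace.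

(** * Openness and density *)

(** The form at x - (b / g) y, where a and g are its values at x and y, and b and c are the
    conjugate cross terms. *)
Lemma complete_square (K : fieldType) (a b c g : K) : g != 0 ->
  a - b / g * c - c / g * b + c / g * (b / g) * g = (g * a - b * c) / g.
Proof. by move=> g0; field. Qed.

Section Openness.
Variables (R : realType) (F : scalars) (n : nat).
Local Notation K := (field_of R F).

(** The interior of the set where X implies U is an open set with trace U on X. *)
Lemma near_relatively_open (T : topologicalType) (X U : set T) :
  U `<=` X -> (forall x, U x -> \forall y \near x, X y -> U y) ->
  relatively_open X U.
Proof.
move=> UX Unear; exists ([set y | X y -> U y]°); first exact: open_interior.
apply/seteqP; split=> [x Ux|x [Xx /interior_subset]]; last exact.
by split; [exact: UX | exact: Unear].
Qed.

Lemma near_neq0 (f : 'M[K]_n -> K) (A : 'M[K]_n) :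
  continuous f -> f A != 0 -> \forall B \near A, f B != 0.
Proof.
move=> fc fA; have ? := nbhs_filter A; exact: (cvgr_neq0 _ (fc A) fA).
Qed.

Lemma GL_open : open (GL : set 'M[K]_n).
Proof.
rewrite openE => A /= uA; rewrite /GL /= unitmxE unitfE in uA *.
have dc : continuous (fun B : 'M[K]_n => \det B).
  by apply: det_continuous => B; exact: cvg_id.
apply: filterS (near_neq0 dc uA) => B /=.
by rewrite /GL /= unitmxE unitfE.
Qed.

Definition herm_form (A : 'M[K]_n) (x y : 'cV[K]_n) : K := (adj x *m A *m y) 0 0.

Lemma herm_form_conj A x y : Sym A -> herm_form A x y = conj_of (herm_form A y x).
Proof.
move=> /Sym_adj AE; rewrite /herm_form.
have -> : adj x *m A *m y = adj (adj y *m A *m x) by rewrite !adjM adjK AE mulmxA.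
by rewrite !mxE.
Qed.

Lemma herm_form_real A x : Sym A -> herm_form A x x \is Num.real.
Proof. by move=> SA; apply/conj_of_fixed; rewrite -herm_form_conj. Qed.

Lemma herm_form_subZ A x y t : Sym A ->
  herm_form A (x - t *: y) (x - t *: y) =
  herm_form A x x - t * conj_of (herm_form A y x)
    - conj_of t * herm_form A y x + conj_of t * t * herm_form A y y.
Proof.
move=> SA; rewrite -herm_form_conj // /herm_form.
have -> : adj (x - t *: y) = adj x - conj_of t *: adj y.
  by apply/matrixP => i j; rewrite !mxE rmorphB rmorphM.
rewrite mulmxBr !mulmxBl -!scalemxAr -!scalemxAl !mxE.
set a := \sum_j _; set b := \sum_j _; set c := \sum_j _; set d := \sum_j _.
by rewrite opprB addrA mulrA [t * _ * _]mulrAC; ring.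
Qed.

Lemma herm_form_sum A x y :
  herm_form A x y = \sum_i \sum_j conj_of (x i 0) * A i j * y j 0.
Proof.
rewrite /herm_form mxE exchange_big /=; apply: eq_bigr => j _.
by rewrite mxE mulr_suml; apply: eq_bigr => i _; rewrite !mxE.
Qed.

Lemma Pos_herm_form A x : Pos A -> x != 0 -> 0 < herm_form A x x.
Proof. by move=> [_]; apply. Qed.

(** The form of A would vanish at a nonzero kernel vector. *)
Lemma Pos_unitmx (A : 'M[K]_n) : Pos A -> A \in unitmx.
Proof.
move=> PA; rewrite -unitmx_tr -row_free_unit; apply: inj_row_free => v vA.
apply/eqP/negPn/negP => v0; have x0 : v^T != 0 by rewrite trmx_eq0.
have := Pos_herm_form PA x0.
by rewrite /herm_form -mulmxA -[A *m _]trmxK trmx_mul trmxK vA trmx0 mulmx0 mxE ltxx.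
Qed.

(* Cauchy-Schwarz for the form A, applied to x and A^-1 e_i. *)
Lemma Pos_coord_bound (A : 'M[K]_n) : Pos A ->
  exists2 g : K, 0 <= g & forall (x : 'cV[K]_n) i, `|x i 0| ^+ 2 <= g * herm_form A x x.
Proof.
move=> PA; have SA : Sym A by case: PA.
have uA := Pos_unitmx PA.
pose y i : 'cV[K]_n := invmx A *m delta_mx i 0.
have y0 i : y i != 0.
  apply/eqP => yi; have : A *m y i = delta_mx i 0 by rewrite mulKVmx.
  rewrite yi mulmx0 => /colP/(_ i); rewrite !mxE !eqxx => /eqP.
  by rewrite eq_sym oner_eq0.
pose g i := herm_form A (y i) (y i).
have g0 i : 0 < g i by apply: Pos_herm_form.
have yx i (x : 'cV[K]_n) : herm_form A (y i) x = x i 0.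
  rewrite /herm_form; have -> : adj (y i) *m A = adj (A *m y i) by rewrite adjM (Sym_adj _).1.
  rewrite mulKVmx // mxE (bigD1 i) //= big1 => [|j ji].
    by rewrite !mxE !eqxx rmorph1 mul1r addr0.
  by rewrite !mxE (negbTE ji) rmorph0 mul0r.
have form_ge0 x : 0 <= herm_form A x x.
  have [->|x0] := eqVneq x 0; first by rewrite /herm_form mulmx0 mxE.
  exact/ltW/Pos_herm_form.
(* The sum dominates every g i, which makes the constant independent of i. *)
exists (\sum_i g i) => [|x i]; first by apply: sumr_ge0 => i _; exact: ltW.
apply: (@le_trans _ _ (g i * herm_form A x x)); last first.
  rewrite ler_wpM2r // (bigD1 i) //= lerDl.
  by apply: sumr_ge0 => j _; exact: ltW.
have := form_ge0 (x - (x i 0 / g i) *: y i).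
rewrite herm_form_subZ // -/(g i) !yx rmorphM fmorphV /=.
have -> : conj_of (g i) = g i by apply/real_conj_of/gtr0_real.
have gi0 : g i != 0 by rewrite gt_eqF.
by rewrite complete_square // mul_conj_of pmulr_lge0 ?invr_gt0 // subr_ge0.
Qed.

(** Changing each entry of A by less than e moves the form at x by at most n^2 e g times its value
    for A, with g from [Pos_coord_bound]. The radius e makes this factor less than 1, so the form
    stays positive. *)
Lemma Pos_relatively_open : relatively_open Sym (Pos : set 'M[K]_n).
Proof.
apply: near_relatively_open => [A []//|A PA].
have [g g0 gP] := Pos_coord_bound PA.
have SA : Sym A by case: PA.
pose m : K := (n * n)%:R.
(* The summand 1 keeps the denominator positive even if m g = 0, and gives m g e < 1. *)
pose e : K := (m * g + 1)^-1.
have mg1 : 0 < m * g + 1 by rewrite ltr_wpDl // mulr_ge0.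
have e0 : 0 < e by rewrite invr_gt0.
have : \forall B \near A, ball A e B by exact: nbhsx_ballx.
apply: filterS => B [_ AB] SB; split=> // x x0.
rewrite -[X in 0 < X]/(herm_form B x x).
set a := herm_form A x x; have a0 : 0 < a by exact: Pos_herm_form.
have xx i j : `|x i 0| * `|x j 0| <= g * a.
  have ga0 : 0 <= g * a by rewrite mulr_ge0 // ltW.
  rewrite -(@ler_pXn2r _ 2) ?nnegrE ?mulr_ge0 ?(ltW a0) // exprMn [X in _ <= X]expr2.
  by rewrite ler_pM ?exprn_ge0.
have wE : a - herm_form B x x = herm_form (A - B) x x.
  by rewrite /a /herm_form mulmxBr mulmxBl !mxE.
have wle : `|a - herm_form B x x| <= m * (e * (g * a)).
  rewrite wE herm_form_sum; apply: le_trans (ler_norm_sum _ _ _) _.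
  have -> : m * (e * (g * a)) = \sum_(i < n) \sum_(j < n) (e * (g * a)).
    by rewrite !sumr_const !card_ord -mulrnA -mulr_natl.
  apply: ler_sum => i _; apply: le_trans (ler_norm_sum _ _ _) _.
  apply: ler_sum => j _; rewrite !normrM norm_conj_of mulrAC mulrC.
  rewrite ler_pM ?mulr_ge0 // !mxE.
  by apply/ltW; have := AB i j; rewrite -ball_normE.
have wlt : m * (e * (g * a)) < a.
  have -> : m * (e * (g * a)) = (m * g) * e * a by ring.
  by rewrite gtr_pMl // /e ltr_pdivrMr // mul1r ltrDl.
(* Both forms take real values, so the difference is at most its norm, which is less than a. *)
have wreal : a - herm_form B x x \is Num.real by rewrite rpredB // herm_form_real.
have := le_lt_trans (real_ler_norm wreal) (le_lt_trans wle wlt).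
by rewrite gtrDl oppr_lt0.
Qed.

End Openness.

(** * Openness of [M_sym] in a linear space, and density of [M_sym_inv] *)

Section MainSets.
Variables (R : realType) (F : scalars) (n : nat).
Local Notation K := (field_of R F).
Variables S S' : {vspace 'cV[K]_n}.

Local Notation Lsub :=
  [set A : 'M[K]_n | Sym A /\ (linfun (mulmx A) @: S <= S')%VS].

Lemma M_sym_sub : M_sym S S' `<=` Lsub.
Proof. by move=> A [SA <-]; split=> //; exact: addvSr. Qed.

(* For A in M_sym, write a basis M' of S' as [M, A M] W with M a basis of S; the
   determinant of Y [M, B M] W, where Y M' = 1, is nonzero for B near A, which
   forces [M, B M] to span S'. *)
Lemma M_sym_relatively_open : (S <= S')%VS -> relatively_open Lsub (M_sym S S').
Proof.
move=> SS'; apply: near_relatively_open => [|A [SA AE]]; first exact: M_sym_sub.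
have [M [MS _]] := vspace_basis_mx S.
have [M' [M'S' [Y YM']]] := vspace_basis_mx S'.
have [W WE] : exists W, M' = row_mx M (A *m M) *m W.
  by apply: col_factor => u; apply/(memv_add_image _ _ MS); rewrite AE; apply/M'S'; exists u.
pose f (B : 'M[K]_n) := \det (Y *m row_mx M (B *m M) *m W).
have fc : continuous f.
  have cc m p (C : 'M[K]_(m, p)) : continuous (fun _ : 'M[K]_n => C).
    by move=> B; have ? := nbhs_filter B; exact: cvg_cst.
  apply: det_continuous; apply: mulmx_continuous => //.
  apply: mulmx_continuous => //; apply: row_mx_continuous => //.
  by apply: mulmx_continuous => // B; exact: cvg_id.
have fA : f A != 0 by rewrite /f -mulmxA -WE YM' det1 oner_eq0.
apply: filterS (near_neq0 fc fA) => B fB [SB BS]; split=> //.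
apply/eqP; rewrite eqEsubv subv_add SS' BS /=.
have [N NE] : exists N, row_mx M (B *m M) = M' *m N.
  apply: col_factor => u; apply/M'S'.
  have : row_mx M (B *m M) *m u \in (S + linfun (mulmx B) @: S)%VS.
    by apply/(memv_add_image _ _ MS); exists u.
  by apply/subvP; rewrite subv_add SS'.
have NWu : N *m W \in unitmx.
  by rewrite unitmxE unitfE; move: fB; rewrite /f NE mulmxA YM' mul1mx.
apply/subvP => x /M'S'[u ->]; apply/(memv_add_image _ _ MS).
(* With [M, B M] = M' N, applying [M, B M] to this vector gives M' (N W) (N W)^-1 u = M' u. *)
exists (W *m (invmx (N *m W) *m u)).
by rewrite NE -!mulmxA [N *m (W *m _)]mulmxA mulKVmx.
Qed.

(** A + t I is singular exactly when t is a root of the characteristic polynomial of -A, of degree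
    n, so n + 1 distinct candidates cannot all fail. *)
Lemma exists_small_shift (A : 'M[K]_n) (e : K) : 0 < e ->
  exists t : K, [/\ 0 < t, t < e & A + t%:M \in unitmx].
Proof.
(* Denominators start at 2 so that every candidate is strictly below e. *)
move=> e0; pose ts := [seq e / k.+2%:R | k <- iota 0 n.+1].
have ts_uniq : uniq ts.
  rewrite map_inj_uniq ?iota_uniq // => i j /(mulfI (lt0r_neq0 e0))/invr_inj/eqP.
  by rewrite eqr_nat => /eqP[].
have : ~~ all (root (char_poly (- A))) ts.
  apply/negP => /max_poly_roots/(_ ts_uniq).
  rewrite monic_neq0 ?char_poly_monic // => /(_ isT).
  by rewrite size_map size_iota size_char_poly ltnn.
case/allPn => _ /mapP[k _ ->] tr; exists (e / k.+2%:R); split.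
- by rewrite divr_gt0 // ltr0n.
- by rewrite ltr_pdivrMr ?ltr0n // ltr_pMr // ltr1n.
move: tr; rewrite -eigenvalue_root_char /eigenvalue negbK /eigenspace kermx_eq0.
by rewrite -opprD /row_free mxrank_opp -/(row_free _) row_free_unit.
Qed.

(** A shift t positive in K is real, so A + t I is still Hermitian; each entry moves by t or 0,
    within the ball of radius e. *)
Lemma M_sym_inv_dense : M_sym S S' `<=` closure (M_sym_inv S S').
Proof.
move=> A [SA AE] U /nbhs_ballP[e e0 eU].
have [t [t0 te tu]] := exists_small_shift A e0.
exists (A + t%:M); split; last first.
  apply: eU; split=> // i j; rewrite -ball_normE /= !mxE opprD addNKr normrN.
  by rewrite normrMn gtr0_norm //; case: (i == j); rewrite ?mulr1n ?mulr0n.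
split=> //; split; last by rewrite add_image_shift.
apply/SymP => i j; rewrite !mxE rmorphD rmorphMn /= -(SymP _).1 //.
by rewrite (real_conj_of (gtr0_real t0)) eq_sym.
Qed.

End MainSets.

(** * Dimension count and conclusion *)

(** Subtraction being truncated, the point is 2 p s <= n (n - 1). For positive p and s it follows
    from 2 p s <= (p + s)(p + s - 1) and p + s <= n. *)
Lemma dimension_arith a n p s : (1 <= n)%N -> (p + s <= n)%N ->
  (a * ((n * (n - 1))./2 - p * s) + n + a * (p * s) = a * (n * (n - 1))./2 + n)%N.
Proof.
move=> n1 psn; have ps : (p * s <= (n * (n - 1))./2)%N.
  rewrite geq_half_double -muln2.
  case: p s psn => [|p] [|s] psn; rewrite ?muln0 ?mul0n //.
  apply: (@leq_trans ((p.+1 + s.+1) * (p + s.+1))); first by nia.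
  by apply: leq_mul; lia.
by rewrite mulnBr addnAC subnK // leq_mul2l ps orbT.
Qed.

Theorem corollary5p12 (R : realType) (F : scalars) (n p q : nat)
    (S S' : {vspace 'cV[field_of R F]_n})
    (hn : (1 <= n)%N) (hSS' : (S <= S')%VS)
    (hp : p = \dim S) (hq : q = (\dim S' - \dim S)%N) (hqp : (q <= p)%N) :
  let d := (alpha F * ((n * (n - 1))./2 - p * (n - p - q)) + n)%N in
  [/\ embedded_submanifold (GL `&` Sym) (sym_atlas (GL `&` Sym)) (M_sym_inv S S') d /\
      embedded_submanifold Pos (sym_atlas Pos) (M_pos S S') d,
      relatively_open (M_sym S S') (M_sym_inv S S') /\
      relatively_open (M_sym S S') (M_pos S S')
    & M_sym_inv S S' `<=` M_sym S S' /\
      M_sym S S' `<=` closure (M_sym_inv S S')].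
Proof.
move=> d; have pS' := dimvS hSS'.
have S'n : (\dim S' <= n)%N by rewrite (leq_trans (dimvS (subvf S'))) // dimvf /dim /= muln1.
have dE : (d + alpha F * (\dim S * (n - \dim S')))%N = sym_dim F n.
  have -> : (n - \dim S' = n - p - q)%N by lia.
  by rewrite /d -hp dimension_arith //; lia.
have [phi0 [psi0 lc0]] := Sym_linear_coordinates R F n.
have [phi [psi lc]] := M_sym_sub_coordinates hSS' dE.
(* The open sets U and V cut [M_sym] out of the linear space and Pos out of Sym. Their intersections
   with each other and with GL supply the remaining openness claims. *)
have [U Uo MU] := M_sym_relatively_open hSS'.
have [V Vo PV] := Pos_relatively_open R F n.
have MSym : M_sym S S' `<=` Sym by move=> A [].
have M_posE : M_pos S S' = M_sym S S' `&` V.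
  by rewrite /M_pos PV setIA (setIidl MSym).
have GLo := @GL_open R F n.
split.
- split; apply: (embedded_linear lc0 _ _ lc).
  + by exists GL => //; rewrite setIC.
  + by move=> A [].
  + by exists (U `&` GL); [exact: openI | rewrite /M_sym_inv MU setIA].
  + by move=> A [[SA _] GA]; split.
  + exact: Pos_relatively_open.
  + by move=> A [].
  + by exists (U `&` V); [exact: openI | rewrite M_posE {1}MU setIA].
  + by move=> A [].
- split; first by exists GL.
  by exists V.
- by split; [move=> A [] | exact: M_sym_inv_dense].
Qed.
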